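(* Let $r \geq 1$ and $d \geq 1$ be integers. Let $H$ be a bipartite graph with bipartition $(V_1,V_2)$ and $m$ edges, such that there are $r$ vertices in $V_1$ each of which is adjacent to every vertex of $V_2$, and every vertex of $V_1$ has degree at least $d$. Then for every graph $G$, $$t_{H}(G) \geq t_{K_{r,d}}(G)^{\frac{m}{rd}}.$$
   Context: All graphs are finite and simple. A homomorphism from a graph $H$ to a graph $G$ is a map $f:V(H)\to V(G)$ such that $(f(u),f(v))$ is an edge of $G$ for every edge $(u,v)$ of $H$. Let $h_H(G)$ denote the number of homomorphisms from $H$ to $G$, and $t_H(G)=h_H(G)/|V(G)|^{|V(H)|}$ (the fraction of all maps $V(H)\to V(G)$ that are homomorphisms). $K_{r,d}$ denotes the complete bipartite graph with parts of sizes $r$ and $d$. *)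

(* Defs.v *)
From HB Require Import structures.
From mathcomp Require Import all_boot all_order all_algebra.
From mathcomp Require Import all_classical all_reals all_analysis.
Set Implicit Arguments. Unset Strict Implicit. Unset Printing Implicit Defensive.
Import Order.TTheory GRing.Theory Num.Theory.

Definition simple_graph (V : finType) (e : rel V) : Prop :=
  symmetric e /\ irreflexive e.

Definition is_hom (VH VG : finType) (eH : rel VH) (eG : rel VG)
  (f : {ffun VH -> VG}) : bool :=
  [forall x, forall y, eH x y ==> eG (f x) (f y)].

Definition hom_count (VH VG : finType) (eH : rel VH) (eG : rel VG) : nat :=
  #|[set f : {ffun VH -> VG} | is_hom eH eG f]|.

Definition hom_density (R : realType) (VH VG : finType) (eH : rel VH) (eG : rel VG) : R :=
  (hom_count eH eG)%:R / (#|VG| ^ #|VH|)%:R.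

Definition edge_set (V : finType) (e : rel V) : {set {set V}} :=
  [set E : {set V} | [exists x, exists y, e x y && (E == [set x; y])]].

Definition num_edges (V : finType) (e : rel V) : nat := #|edge_set e|.

Definition degree (V : finType) (e : rel V) (x : V) : nat := #|[set y | e x y]|.

Definition Krd_rel (r d : nat) : rel ('I_r + 'I_d) :=
  fun x y => match x, y with
             | inl _, inr _ => true
             | inr _, inl _ => true
             | _, _ => false
             end.

Definition is_bipartition (V : finType) (e : rel V) (V1 : {set V}) : Prop :=
  forall x y, e x y -> (x \in V1) != (y \in V1).
Arguments Krd_rel r d : clear implicits.

(* Main.v *)
(* Entropy argument.  Let S be the r full vertices of V_1, J = V_2, n = |J|, and
   let c(x) be the size of the common neighbourhood of x : S -> V(G).  Choose x
   with probability proportional to c(x)^d, then the n values of y : J -> V(G)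
   independently among the common neighbours of x; this is the law
   mu(x, y) = c(x)^(d - n) / T, T = sum_x c(x)^d = h_{K_{r,d}}(G), on compatible
   pairs.  Three uses of Gibbs' inequality (ln of a total weight dominates the
   expected log-ratio of the weight to mu) give, with N = |V(G)|, c(y_B) the
   number of common neighbours of y(B), and E the expectation under mu:
     ln h_H >= ln T + (n - d) E ln c(x) + sum_k E ln c(y_{B_k}),
     d E ln c(x) >= ln T - r ln N,
     r E ln c(y_B) >= ln T + (|B| - d) E ln c(x) - |B| ln N,
   where B_k is the neighbourhood of the k-th vertex of V_1 outside S.  These
   combine linearly since n >= d and |B_k| >= d. *)
Require Import Defs.
From HB Require Import structures.
From mathcomp Require Import all_boot all_order all_algebra.
From mathcomp Require Import all_classical all_reals all_analysis.
From mathcomp Require Import ring lra.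
Set Implicit Arguments. Unset Strict Implicit. Unset Printing Implicit Defensive.
Import Order.TTheory GRing.Theory Num.Theory.
Local Open Scope ring_scope.

(** * Logarithms and Gibbs' inequality *)

Lemma ln_prod (R : realType) (I : finType) (F : I -> R) :
  (forall i, 0 < F i) -> ln (\prod_i F i) = \sum_i ln (F i).
Proof.
move=> F0; apply: (@proj2 (0 < \prod_i F i)).
apply: (big_rec2 (fun a b => 0 < a /\ ln a = b)); first by rewrite ltr01 ln1.
by move=> i a b _ [a0 <-]; rewrite mulr_gt0 // lnM // posrE.
Qed.

Lemma ln_natX (R : realType) (m n : nat) : (0 < m)%N ->
  ln ((m ^ n)%:R : R) = n%:R * ln m%:R.
Proof. by move=> m0; rewrite natrX lnXn ?ltr0n // mulr_natl. Qed.

(** Apply ln t <= t - 1 at t = q(a) / (mu(a) Q), multiply by mu(a) and sum: the right-hand sides add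
    up to (sum of q) / Q - 1 <= 0. *)
Lemma gibbs (R : realType) (A : finType) (P : pred A) (mu q : A -> R) (Q : R) :
  (forall a, P a -> 0 < mu a) -> (forall a, P a -> 0 < q a) ->
  \sum_(a | P a) mu a = 1 -> \sum_(a | P a) q a <= Q ->
  \sum_(a | P a) mu a * (ln (q a) - ln (mu a)) <= ln Q.
Proof.
move=> mu0 q0 mu1 qQ.
have [a0 Pa0] : exists a, P a.
  apply/existsP; apply: contra_eqT mu1; rewrite negb_exists => /forallP nP.
  by rewrite big_pred0 => [|a]; [rewrite eq_sym oner_eq0 | apply/negbTE].
have Q0 : 0 < Q.
  apply: lt_le_trans qQ; rewrite (bigD1 a0) //= ltr_pwDl ?q0 //.
  by apply: sumr_ge0 => a /andP[/q0/ltW].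
rewrite -subr_le0 -[ln Q]mul1r -[X in X * ln Q]mu1 mulr_suml -sumrB.
apply: (@le_trans _ _ (\sum_(a | P a) (q a / Q - mu a))).
  apply: ler_sum => a Pa; have m0 := mu0 _ Pa; have qa := q0 _ Pa.
  have r0 : 0 < q a / (mu a * Q) by rewrite divr_gt0 ?mulr_gt0.
  have := @le_ln1Dx R (q a / (mu a * Q) - 1).
  rewrite [1 + _]addrC subrK ltrBrDr addNr => /(_ r0).
  rewrite ln_div ?posrE ?mulr_gt0 // lnM ?posrE // => lnq.
  rewrite -mulrBr -addrA -opprD (le_trans (ler_wpM2l (ltW m0) lnq)) // le_eqVlt; apply/orP; left.
  by apply/eqP; field; rewrite !gt_eqF.
by rewrite sumrB mu1 -mulr_suml subr_le0 ler_pdivrMr // mul1r.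
Qed.

(** * Common neighbourhoods and compatible pairs *)

Definition cnbr (V : finType) (e : rel V) (I : finType) (x : {ffun I -> V})
  (B : {set I}) : {set V} := [set v | [forall i in B, e (x i) v]].

(** With [B] the full set this is c(x); with [B] the neighbourhood B_k it is c(y_{B_k}). *)
Definition cdeg (V : finType) (e : rel V) (I : finType) (x : {ffun I -> V})
  (B : {set I}) : nat := #|cnbr e x B|.

(** Compatible pairs are the homomorphisms of the complete bipartite graph on [I] and [J], split
    along its two sides. *)
Definition compat (V : finType) (e : rel V) (I J : finType)
  (x : {ffun I -> V}) (y : {ffun J -> V}) : bool :=
  [forall i, forall j, e (x i) (y j)].

(* A representative of the restriction of y to B that stays in the same type. *)
Definition fixoff (V J : finType) (v0 : V) (B : {set J}) (y : {ffun J -> V}) :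
  {ffun J -> V} := [ffun j => if j \in B then y j else v0].

Lemma compatP (V : finType) (e : rel V) (I J : finType)
  (x : {ffun I -> V}) (y : {ffun J -> V}) :
  reflect (forall i j, e (x i) (y j)) (compat e x y).
Proof. exact: 'forall_forallP. Qed.

Lemma card_compat (V : finType) (e : rel V) (I J : finType)
  (x : {ffun I -> V}) :
  #|[pred y : {ffun J -> V} | compat e x y]| = (cdeg e x finset.setT ^ #|J|)%N.
Proof.
rewrite -card_ffun_on; apply: eq_card => y; rewrite !inE.
apply/compatP/ffun_onP => [xy j|xy i j].
  by rewrite inE; apply/forallP => i; rewrite inE xy.
by have := xy j; rewrite inE => /forallP/(_ i); rewrite inE.
Qed.

(** Coordinates in [B] are pinned to those of [t], while each coordinate off [B] ranges
    independently over the common neighbours of [x]. *)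
Lemma card_fixoff_fiber (V : finType) (e : rel V) (I J : finType)
  (v0 : V) (x : {ffun I -> V}) (B : {set J}) (t : {ffun J -> V}) :
  fixoff v0 B t = t -> (forall i j, j \in B -> e (x i) (t j)) ->
  #|[pred y : {ffun J -> V} | compat e x y & fixoff v0 B y == t]|
  = (cdeg e x finset.setT ^ #|~: B|)%N.
Proof.
move=> tB xt.
pose F j : pred V := if j \in B then pred1 (t j) else mem (cnbr e x finset.setT).
have -> : #|[pred y : {ffun J -> V} | compat e x y & fixoff v0 B y == t]|
    = #|family F|.
  apply: eq_card => y; rewrite !inE; apply/andP/familyP => [[/compatP xy /eqP yt] j|yF].
    rewrite /F -yt ffunE; case: ifP => jB; rewrite !inE ?jB //.
    by apply/forallP => i; rewrite inE xy.
  split.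
    apply/compatP => i j; have := yF j; rewrite /F; case: ifP => jB; rewrite !inE.
      by move=> /eqP ->; apply: xt.
    by move=> /forallP/(_ i); rewrite inE.
  apply/eqP/ffunP => j; rewrite -tB !ffunE; case: ifP => // jB.
  by have := yF j; rewrite /F jB !inE => /eqP.
rewrite card_family foldrE big_map big_enum /= (bigID (mem B)) /=.
rewrite big1 ?mul1n => [|j jB]; last by rewrite /F jB card1.
rewrite (eq_bigr (fun=> cdeg e x finset.setT)) => [|j jB]; last by rewrite /F (negbTE jB).
by rewrite prod_nat_const; congr (_ ^ _)%N; apply: eq_card => j; rewrite !inE.
Qed.

Lemma cdeg_fixoff (V : finType) (e : rel V) (J : finType) (v0 : V)
  (B : {set J}) (y : {ffun J -> V}) : cdeg e (fixoff v0 B y) B = cdeg e y B.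
Proof.
apply: eq_card => v; rewrite !inE; apply: eq_forallb => j.
by rewrite ffunE; case: (j \in B).
Qed.

Lemma card_fixoff (V J : finType) (v0 : V) (B : {set J}) :
  #|[pred t : {ffun J -> V} | fixoff v0 B t == t]| = (#|V| ^ #|B|)%N.
Proof.
rewrite -(card_pffun_on v0); apply: eq_card => t; rewrite !inE.
apply/eqP/pffun_onP => [<-|[tB _]].
  split=> //; apply/fintype.subsetP => j; rewrite !inE ffunE; case: ifP => // _.
  by rewrite eqxx.
apply/ffunP => j; rewrite ffunE; case: ifP => // jB.
by apply/esym/eqP; apply: contraFT jB => tj; apply: (fintype.subsetP tB); rewrite inE.
Qed.

(* This weight makes the last Gibbs bound work: summing out y off B cancels the
   power of c(x), and then summing out x cancels the power of c(y_B). *)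
Lemma sum_codegree_le (R : realType) (V : finType) (e : rel V)
  (I J : finType) (B : {set J}) : symmetric e -> (0 < #|B|)%N ->
  \sum_(p : {ffun I -> V} * {ffun J -> V} | compat e p.1 p.2)
    ((cdeg e p.2 B ^ #|I|)%:R^-1 * (cdeg e p.1 finset.setT ^ #|~: B|)%:R^-1)
  <= (#|V| ^ #|B|)%:R :> R.
Proof.
move=> esym /card_gt0P[b bB].
(* As [B] is nonempty, an empty [V] leaves no [y] at all; otherwise [v0] serves as the filler of
   [fixoff]. *)
have [v0 _|V0] := pickP (xpredT : pred V); last first.
  rewrite big_pred0 ?ler0n // => -[x y]; by have := V0 (y b).
pose G (t : {ffun J -> V}) : R := (cdeg e t B ^ #|I|)%:R^-1.
pose Q (x : {ffun I -> V}) (t : {ffun J -> V}) :=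
  (fixoff v0 B t == t) && [forall i, forall j in B, e (x i) (t j)].
rewrite -(pair_big_dep xpredT (fun x y => compat e x y)
  (fun x y => G y * (cdeg e x finset.setT ^ #|~: B|)%:R^-1)) /=.
apply: (@le_trans _ _ (\sum_(x : {ffun I -> V}) \sum_(t | Q x t) G t)).
  apply: ler_sum => x _.
  rewrite (partition_big (fixoff v0 B) (Q x)) /=; last first.
    move=> y /compatP xy; apply/andP; split.
      by apply/eqP/ffunP => j; rewrite !ffunE; case: (j \in B).
    by apply/forallP => i; apply/forall_inP => j jB; rewrite ffunE jB; exact: xy.
  apply: ler_sum => t /andP[/eqP tB /forallP xt].
  rewrite (eq_bigr (fun=> G t * (cdeg e x finset.setT ^ #|~: B|)%:R^-1)); last first.
    by move=> y /andP[_ /eqP <-]; rewrite /G cdeg_fixoff.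
  rewrite sumr_const (card_fixoff_fiber tB) => [|i j jB]; last first.
    by have /forall_inP := xt i; apply.
  rewrite -[X in X <= _]mulr_natr -mulrA ler_piMr // ?invr_ge0 ?ler0n //.
  (* An empty fibre contributes 0 instead of [G t], so this is an inequality. *)
  have [->|c0] := eqVneq (cdeg e x finset.setT ^ #|~: B|)%N 0%N; first by rewrite mulr0.
  by rewrite mulVf // pnatr_eq0.
rewrite (exchange_big_dep [pred t | fixoff v0 B t == t]) /=; last first.
  by move=> x t _ /andP[].
rewrite -(card_fixoff v0 B) -[X in _ <= X]sumr_const.
apply: ler_sum => t tB; rewrite sumr_const.
have -> : #|[pred x | Q x t]| = (cdeg e t B ^ #|I|)%N.
  rewrite -card_ffun_on; apply: eq_card => x; rewrite !inE [Q _ _]/Q tB /=.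
  apply/forallP/ffun_onP => [xt i|xt i].
    rewrite inE; apply/forall_inP => j jB; rewrite esym.
    by have /forall_inP := xt i; apply.
  apply/forall_inP => j jB; rewrite esym.
  by have := xt i; rewrite inE => /forall_inP; apply.
rewrite /G -[X in X <= _]mulr_natr.
have [->|c0] := eqVneq (cdeg e t B ^ #|I|)%N 0%N; first by rewrite mulr0.
by rewrite mulVf // pnatr_eq0.
Qed.

(** * The entropy bound *)

Lemma compat_cdeg_gt0 (V : finType) (e : rel V) (I J : finType)
  (x : {ffun I -> V}) (y : {ffun J -> V}) (B : {set J}) :
  symmetric e -> (0 < #|I|)%N -> compat e x y -> (0 < cdeg e y B)%N.
Proof.
move=> esym /card_gt0P[i _] /compatP xy; apply/card_gt0P; exists (x i).
by rewrite inE; apply/forall_inP => j _; rewrite esym.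
Qed.

Lemma compat_sym (V : finType) (e : rel V) (I J : finType)
  (x : {ffun I -> V}) (y : {ffun J -> V}) :
  symmetric e -> compat e x y = compat e y x.
Proof.
by move=> esym; apply/compatP/compatP => xy i j; rewrite esym.
Qed.

(** For [I] = S, [J] = V_2 and [K] the rest of V_1, the fraction is m/(rd) and #|I| + #|J| + #|K| is
    |V(H)|: this is the theorem after taking logarithms, with [T] and [h] in place of the two
    homomorphism counts. *)
Lemma log_density_bound (R : realType) (V : finType) (e : rel V)
  (I J K : finType) (B : K -> {set J}) (d T h : nat) :
  symmetric e -> (0 < #|I|)%N -> (0 < d)%N -> (d <= #|J|)%N ->
  (forall k, d <= #|B k|)%N ->
  T = (\sum_(x : {ffun I -> V}) cdeg e x finset.setT ^ d)%N ->
  h = (\sum_(p : {ffun I -> V} * {ffun J -> V} | compat e p.1 p.2)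
        \prod_k cdeg e p.2 (B k))%N ->
  (0 < T)%N ->
  (0 < h)%N /\
  (#|I| * #|J| + \sum_k #|B k|)%:R / (#|I| * d)%:R
    * (ln T%:R - (#|I| + d)%:R * ln #|V|%:R)
  <= ln h%:R - (#|I| + #|J| + #|K|)%:R * ln #|V|%:R :> R.
Proof.
move=> esym I0 d0 dJ dB TE hE T0.
pose P (p : {ffun I -> V} * {ffun J -> V}) := compat e p.1 p.2.
pose c (p : {ffun I -> V} * {ffun J -> V}) := cdeg e p.1 finset.setT.
pose b (p : {ffun I -> V} * {ffun J -> V}) k := cdeg e p.2 (B k).
have J0 : (0 < #|J|)%N by apply: leq_trans dJ.
have c_gt0 p : P p -> (0 < c p)%N.
  by rewrite /P compat_sym // => /(compat_cdeg_gt0 _ esym J0); apply.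
have b_gt0 p k : P p -> (0 < b p k)%N.
  by move=> /(compat_cdeg_gt0 _ esym I0); apply.
have TR : (0 : R) < T%:R by rewrite ltr0n.
pose L : R := ln T%:R; pose N : R := ln #|V|%:R.
(* The exponent d - n is at most 0, so c(x)^(d - n) is written as a quotient of natural powers. *)
pose mu p : R := (c p ^ d)%:R / (c p ^ #|J|)%:R / T%:R.
have mu_gt0 p : P p -> 0 < mu p.
  by move=> /c_gt0 cp; rewrite /mu !divr_gt0 // ltr0n expn_gt0 cp.
have ln_mu p : P p -> ln (mu p) = (d%:R - #|J|%:R) * ln (c p)%:R - L.
  move=> /c_gt0 cp; rewrite /mu !ln_div ?posrE ?divr_gt0 ?ltr0n ?expn_gt0 ?cp //.
  by rewrite !ln_natX // mulrBl.
(* Each [x] has c(x)^n compatible [y], where n = #|J|. *)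
have sum_x (g : nat -> R) :
    \sum_(p | P p) g (c p) =
    \sum_(x : {ffun I -> V}) (cdeg e x finset.setT ^ #|J|)%:R * g (cdeg e x finset.setT).
  rewrite -(pair_big_dep xpredT (fun x y => compat e x y)
    (fun x (y : {ffun J -> V}) => g (cdeg e x finset.setT))) /=.
  apply: eq_bigr => x _; rewrite sumr_const -(card_compat e J x) mulr_natl.
  by congr (_ *+ _).
have mu1 : \sum_(p | P p) mu p = 1.
  rewrite (sum_x (fun m => (m ^ d)%:R / (m ^ #|J|)%:R / T%:R)).
  transitivity (\sum_(x : {ffun I -> V}) (cdeg e x finset.setT ^ d)%:R / T%:R : R).
    apply: eq_bigr => x _; rewrite mulrA; congr (_ / _).
    (* If c(x) = 0, both sides vanish because [d] and #|J| are positive. *)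
    have [->|x0] := posnP (cdeg e x finset.setT); first by rewrite !exp0n // mul0r.
    by rewrite mulrC divfK // pnatr_eq0 -lt0n expn_gt0 x0.
  by rewrite -mulr_suml -natr_sum -TE divff // gt_eqF.
pose E (f : _ -> R) : R := \sum_(p | P p) mu p * f p.
have eqE f g : (forall p, P p -> f p = g p) -> E f = E g.
  by move=> fg; apply: eq_bigr => p Pp; rewrite fg.
have ED f g : E (fun p => f p + g p) = E f + E g.
  by rewrite -big_split; apply: eq_bigr => p _; rewrite mulrDr.
have EZ k f : E (fun p => k * f p) = k * E f.
  by rewrite mulr_sumr; apply: eq_bigr => p _; rewrite mulrCA.
have EC k : E (fun=> k) = k by rewrite /E -mulr_suml mu1 mul1r.
pose a := E (fun p => ln (c p)%:R).
pose be k := E (fun p => ln (b p k)%:R).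
have cardV (X : finType) : #|{ffun X -> V}| = (#|V| ^ #|X|)%N by exact: card_ffun.
(* Since T > 0, some [x0] has a common neighbour [v]; pairing it with the constant map [v] gives a
   compatible pair, whence h > 0. *)
have [x0 cx0] : exists x : {ffun I -> V}, (0 < cdeg e x finset.setT)%N.
  move: T0; rewrite TE lt0n sum_nat_eq0 negb_forall => /existsP[x].
  by rewrite expn_eq0 d0 andbT /= -lt0n => cx; exists x.
have /card_gt0P[v vx0] := cx0.
have V0 : (0 < #|V|)%N by apply/card_gt0P; exists v.
have P0 : P (x0, [ffun=> v]).
  apply/compatP => i j /=; rewrite ffunE.
  by move: vx0; rewrite inE => /forallP/(_ i); rewrite inE.
have h0 : (0 < h)%N.
  rewrite hE lt0n sum_nat_eq0 negb_forall; apply/existsP; exists (x0, [ffun=> v]).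
  rewrite negb_imply -lt0n; apply/andP; split; first exact: P0.
  by apply: prodn_gt0 => k; exact: (b_gt0 _ k P0).
split=> //.
(* Gibbs with the summand of [h] as weight, of total exactly [h]. *)
have main : L + (#|J|%:R - d%:R) * a + \sum_k be k <= ln h%:R.
  have := @gibbs R _ P mu (fun p => (\prod_k b p k)%:R) h%:R mu_gt0.
  have q0 p : P p -> (0 : R) < (\prod_k b p k)%:R.
    by move=> Pp; rewrite ltr0n prodn_gt0 // => k; apply: b_gt0.
  move=> /(_ q0 mu1); rewrite -natr_sum hE lexx => /(_ isT).
  rewrite -hE -[X in X <= _]/(E _).
  rewrite (eqE _ (fun p => (L + (#|J|%:R - d%:R) * ln (c p)%:R)
     + \sum_k ln (b p k)%:R)); last first.
    move=> p Pp; rewrite ln_mu // natr_prod ln_prod; first by ring.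
    by move=> k; rewrite ltr0n b_gt0.
  rewrite !ED EC EZ.
  suff -> : E (fun p => \sum_k ln (b p k)%:R) = \sum_k be k by [].
  by rewrite exchange_big; apply: eq_bigr => p _; rewrite mulr_sumr.
(* Gibbs with weight c(x)^(-n): summing over [y] leaves at most 1 for each [x]. *)
have abound : L - #|I|%:R * N <= d%:R * a.
  have := @gibbs R _ P mu (fun p => (c p ^ #|J|)%:R^-1) (#|V| ^ #|I|)%:R mu_gt0.
  have q0 p : P p -> (0 : R) < (c p ^ #|J|)%:R^-1.
    by move=> /c_gt0 cp; rewrite invr_gt0 ltr0n expn_gt0 cp.
  move=> /(_ q0 mu1); rewrite (sum_x (fun m => (m ^ #|J|)%:R^-1)).
  rewrite -cardV -sumr_const => le1.
  have {}/le1 : \sum_(x : {ffun I -> V}) (cdeg e x finset.setT ^ #|J|)%:R *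
     (cdeg e x finset.setT ^ #|J|)%:R^-1 <= \sum_(x in {: {ffun I -> V}}) 1 :> R.
    apply: ler_sum => x _.
    have [->|n0] := eqVneq (cdeg e x finset.setT ^ #|J|)%N 0%N; first by rewrite mul0r.
    by rewrite mulfV // pnatr_eq0.
  rewrite sumr_const cardV ln_natX // -[X in X <= _]/(E _).
  rewrite (eqE _ (fun p => L + (- d%:R) * ln (c p)%:R)); last first.
    move=> p Pp; rewrite ln_mu // lnV ?posrE ?ltr0n ?expn_gt0 ?c_gt0 //.
    by rewrite ln_natX ?c_gt0 //; ring.
  by rewrite ED EC EZ -/a -/N; lra.
(* In the log-ratio the exponent of c(x) is -(n - |B_k|) - (d - n) = |B_k| - d. *)
have bbound k : L + (#|B k|%:R - d%:R) * a - #|B k|%:R * N <= #|I|%:R * be k.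
  have := @gibbs R _ P mu
    (fun p => (b p k ^ #|I|)%:R^-1 * (c p ^ #|~: B k|)%:R^-1) (#|V| ^ #|B k|)%:R mu_gt0.
  have q0 p : P p -> (0 : R) < (b p k ^ #|I|)%:R^-1 * (c p ^ #|~: B k|)%:R^-1.
    move=> Pp; rewrite mulr_gt0 // invr_gt0 ltr0n expn_gt0 ?c_gt0 //.
    by rewrite b_gt0.
  move=> /(_ q0 mu1); have Bk : (0 < #|B k|)%N by apply: leq_trans (dB k).
  move=> /(_ (sum_codegree_le R I esym Bk)).
  rewrite ln_natX // -[X in X <= _]/(E _).
  rewrite (eqE _ (fun p => L + (- #|I|%:R) * ln (b p k)%:R
       + (#|B k|%:R - d%:R) * ln (c p)%:R)); last first.
    move=> p Pp; rewrite ln_mu // lnM ?posrE ?invr_gt0 ?ltr0n ?expn_gt0 ?c_gt0 ?b_gt0 //.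
    rewrite !lnV ?posrE ?ltr0n ?expn_gt0 ?c_gt0 ?b_gt0 //.
    rewrite !ln_natX ?c_gt0 ?b_gt0 // -(cardsC (B k)) natrD; ring.
  by rewrite !ED EC !EZ -/a -/(be k) -/N; lra.
pose n : R := #|J|%:R; pose r : R := #|I|%:R; pose l := L - (r + d%:R) * N.
have dR : (0 : R) < d%:R by rewrite ltr0n.
have rR : 0 < r by rewrite ltr0n.
(* Here [l] is the log-density of K_{r,d}. The target splits into n s for the rn edges at S and
   |B_k| s / r for those at each k; both follow by writing n or |B_k| as d plus a nonnegative rest,
   with d s = l and s <= a - N on the rest. *)
pose s := l / d%:R; have lE : l = d%:R * s by rewrite /s; field; rewrite gt_eqF.
have sa : s <= a - N by rewrite ler_pdivrMr // /l /r; lra.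
have sJ : n * s <= L + (n - d%:R) * a - (r + n) * N.
  have nd : 0 <= n - d%:R by rewrite subr_ge0 ler_nat.
  have := ler_wpM2l nd sa; move: lE; rewrite /l; lra.
have sK k : #|B k|%:R * s / r <= be k - N.
  have nd : 0 <= #|B k|%:R - d%:R :> R by rewrite subr_ge0 ler_nat.
  rewrite ler_pdivrMr //; have := ler_wpM2l nd sa.
  by have := bbound k; move: lE; rewrite /l -/r; lra.
have -> : (#|I| * #|J| + \sum_k #|B k|)%:R / (#|I| * d)%:R
    * (L - (#|I| + d)%:R * N) = n * s + \sum_k #|B k|%:R * s / r.
  rewrite -!mulr_suml natrD !natrM natrD natr_sum -/n -/r -/l lE.
  by field; rewrite !gt_eqF.
apply: (@le_trans _ _ (L + (n - d%:R) * a - (r + n) * N + \sum_k (be k - N))).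
  by rewrite lerD // ler_sum.
rewrite sumrB sumr_const -[N *+ _]mulr_natl !natrD -/n -/r -/N.
rewrite (_ : #|xpredT| = #|K|) //.
move: main; rewrite -/n; lra.
Qed.

(** * Homomorphism and edge counts in terms of compatible pairs and degrees *)

(** The sum counts compatible pairs (x, y) with [y] a d-tuple; restricting a homomorphism to the two
    sides, relabelled by [enum_rank], is an injection into them. *)
Lemma hom_count_Krd_le (V : finType) (e : rel V) (I : finType) (d : nat) :
  (hom_count (Krd_rel #|I| d) e <=
   \sum_(x : {ffun I -> V}) cdeg e x finset.setT ^ d)%N.
Proof.
have -> : (\sum_(x : {ffun I -> V}) cdeg e x finset.setT ^ d)%N =
    #|[set p : {ffun I -> V} * {ffun 'I_d -> V} | compat e p.1 p.2]|.
  rewrite -sum1dep_card -(pair_big_dep xpredT (fun x y => compat e x y)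
    (fun _ _ => 1%N)) /=.
  by apply: eq_bigr => x _; rewrite sum1_card card_compat card_ord.
pose phi (f : {ffun 'I_#|I| + 'I_d -> V}) : {ffun I -> V} * {ffun 'I_d -> V} :=
  ([ffun i => f (inl (enum_rank i))], [ffun j => f (inr j)]).
have phi_inj : injective phi.
  move=> f g [/ffunP fg1 /ffunP fg2]; apply/ffunP => -[i|j].
    by have := fg1 (enum_val i); rewrite !ffunE enum_valK.
  by have := fg2 j; rewrite !ffunE.
rewrite /hom_count -(card_imset _ phi_inj); apply: subset_leq_card.
apply/fintype.subsetP => _ /imsetP[f + ->]; rewrite !inE => /'forall_forallP fE.
by apply/compatP => i j; rewrite !ffunE; apply: (implyP (fE _ _)).
Qed.

(** Orient each edge away from its unique end in [V1]; uniqueness makes (a, b) -> {a, b} injective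
    on these pairs. *)
Lemma card_bipartite_edges (V : finType) (e : rel V) (V1 : {set V}) :
  symmetric e -> is_bipartition e V1 ->
  num_edges e = (\sum_(a in V1) degree e a)%N.
Proof.
move=> e_sym bip.
pose D := [set p : V * V | (p.1 \in V1) && e p.1 p.2].
have -> : (\sum_(a in V1) degree e a)%N = #|D|.
  rewrite -sum1dep_card -(pair_big_dep (mem V1) e (fun _ _ => 1%N)) /=.
  by apply: eq_bigr => a _; rewrite sum1dep_card.
rewrite -(card_in_imset (f := fun p : V * V => [set p.1; p.2])); last first.
  have V2 p : p \in D -> p.2 \notin V1.
    by rewrite inE => /andP[p1 /bip]; rewrite p1; case: (p.2 \in V1).
  have side p q : p \in D -> q \in D -> [set p.1; p.2] = [set q.1; q.2] -> p.1 = q.1.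
    move=> pD qD /setP/(_ p.1); rewrite !inE eqxx /= => /esym/orP[/eqP //|/eqP p1q].
    by move: pD (V2 q qD); rewrite inE -p1q => /andP[-> _].
  move=> p q pD qD pq; have p1 := side p q pD qD pq.
  case: p q pD qD pq p1 => [a b] [a' b'] pD qD /= pq aa'; subst a'; congr pair.
  have /setP/(_ b) := pq; rewrite !inE eqxx orbT => /esym/orP[/eqP ba|/eqP //].
  by move: pD (V2 _ pD); rewrite inE /= ba => /andP[-> _].
apply: eq_card => E; rewrite inE; apply/idP/imsetP.
  move=> /existsP[x /existsP[y /andP[xy /eqP ->]]].
  have := bip _ _ xy; have [x1|x1] := boolP (x \in V1) => y1.
    by exists (x, y); rewrite // inE x1.
  exists (y, x); last by rewrite finset.setUC.
  by rewrite inE /= e_sym xy andbT; case: (y \in V1) y1.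
case=> -[x y]; rewrite inE /= => /andP[_ xy] ->.
by apply/existsP; exists x; apply/existsP; exists y; rewrite xy eqxx.
Qed.

(** Given a compatible (x, y), each vertex k of V_1 outside [S] may be sent independently to any
    common neighbour of y(B_k); distinct choices glue to distinct homomorphisms. *)
Lemma hom_count_ge (VH V : finType) (eH : rel VH) (e : rel V)
  (V1 S : {set VH}) (v0 : V) :
  symmetric eH -> symmetric e -> is_bipartition eH V1 -> S \subset V1 ->
  (\sum_(p : {ffun {a | a \in S} -> V} * {ffun {a | a \in ~: V1} -> V}
       | compat e p.1 p.2)
     \prod_(k : {a | a \in V1 :\: S}) cdeg e p.2 [set j | eH (val k) (val j)]
   <= hom_count eH e)%N.
Proof.
move=> eHsym esym bip SV1.
pose I : finType := {a | a \in S}; pose J : finType := {a | a \in ~: V1}.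
pose K : finType := {a | a \in V1 :\: S}.
pose B (k : K) : {set J} := [set j | eH (val k) (val j)].
pose good (q : {ffun I -> V} * {ffun J -> V} * {ffun K -> V}) :=
  compat e q.1.1 q.1.2 && (q.2 \in family (fun k => mem (cnbr e q.1.2 (B k)))).
have -> : (\sum_(p : {ffun I -> V} * {ffun J -> V} | compat e p.1 p.2)
    \prod_k cdeg e p.2 (B k))%N = #|[set q | good q]|.
  rewrite -sum1dep_card -(pair_big_dep
    (fun p : {ffun I -> V} * {ffun J -> V} => compat e p.1 p.2)
    (fun p (z : {ffun K -> V}) => z \in family (fun k => mem (cnbr e p.2 (B k))))
    (fun _ _ => 1%N)) /=.
  apply: eq_bigr => p _; rewrite sum1_card card_family foldrE big_map big_enum /=.
  by [].
(* The sets S, V_2 and V_1 minus S partition the vertices, so the final branch [v0] is never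
   reached. *)
pose phi (q : {ffun I -> V} * {ffun J -> V} * {ffun K -> V}) : {ffun VH -> V} :=
  [ffun a => if insub a is Some i then q.1.1 i else
             if insub a is Some j then q.1.2 j else
             if insub a is Some k then q.2 k else v0].
have phiI q (i : I) : phi q (val i) = q.1.1 i by rewrite ffunE valK.
have phiJ q (j : J) : phi q (val j) = q.1.2 j.
  rewrite ffunE insubN ?valK //.
  have := valP j; rewrite inE; apply: contra; exact: (fintype.subsetP SV1).
have phiK q (k : K) : phi q (val k) = q.2 k.
  have := valP k; rewrite inE => /andP[kS k1].
  by rewrite ffunE insubN // insubN ?valK // inE k1.
have phi_inj : injective phi.
  move=> q q' /ffunP qq'; case: q q' qq' => [[x y] z] [[x' y'] z'] qq'.
  congr (_, _, _); apply/ffunP => i.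
  - by have := qq' (val i); rewrite !phiI.
  - by have := qq' (val i); rewrite !phiJ.
  - by have := qq' (val i); rewrite !phiK.
rewrite /hom_count -(card_imset _ phi_inj); apply: subset_leq_card.
apply/fintype.subsetP => _ /imsetP[q + ->]; rewrite !inE => /andP[/compatP xy /familyP zF].
have hom a b : a \in V1 -> eH a b -> e (phi q a) (phi q b).
  move=> a1 ab; have b1 : b \in ~: V1.
    by have := bip _ _ ab; rewrite a1 inE; case: (b \in V1).
  rewrite -[b]/(val (exist _ b b1 : J)) phiJ.
  have [aS|aS] := boolP (a \in S).
    by rewrite -[a]/(val (exist _ a aS : I)) phiI.
  have aK : a \in V1 :\: S by rewrite inE aS.
  rewrite -[a]/(val (exist _ a aK : K)) phiK esym.
  have := zF (exist _ a aK : K); rewrite inE => /forall_inP; apply.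
  by rewrite inE.
apply/'forall_forallP => a b; apply/implyP => ab.
have [a1|a1] := boolP (a \in V1); first exact: hom.
rewrite esym; apply: hom; last by rewrite eHsym.
by have := bip _ _ ab; rewrite (negbTE a1); case: (b \in V1).
Qed.

(** * Translation to densities *)

Theorem theorem1p3 (R : realType) (r d : nat) (VH : finType) (eH : rel VH)
  (V1 : {set VH}) :
  (1 <= r)%N -> (1 <= d)%N ->
  simple_graph eH ->
  is_bipartition eH V1 ->
  (exists S : {set VH}, [/\ S \subset V1, #|S| = r &
      forall x y, x \in S -> y \in ~: V1 -> eH x y]) ->
  (forall x, x \in V1 -> (d <= degree eH x)%N) ->
  forall (VG : finType) (eG : rel VG), simple_graph eG ->
    hom_density R eH eG >=
    powR (hom_density R (Krd_rel r d) eG)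
         ((num_edges eH)%:R / (r * d)%:R).
Proof.
move=> r0 d0 [eHsym _] bip [S [SV1 cardS SV2]] dV1 VG eG [esym _].
pose I : finType := {a | a \in S}; pose J : finType := {a | a \in ~: V1}.
pose K : finType := {a | a \in V1 :\: S}.
pose B (k : K) : {set J} := [set j | eH (val k) (val j)].
have cI : #|I| = r by rewrite card_sig -cardS; apply: eq_card.
have cJ : #|J| = #|~: V1| by rewrite card_sig; apply: eq_card.
have cH : #|VH| = (#|I| + #|J| + #|K|)%N.
  rewrite cI -cardS cJ card_sig -(cardsC V1) -(cardsID S V1).
  rewrite (finset.setIidPr SV1) addnAC; congr (_ + _ + _)%N.
have N2 a b : a \in V1 -> eH a b -> b \in ~: V1.
  by move=> a1 /bip; rewrite a1 inE; case: (b \in V1).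
have degS a : a \in S -> degree eH a = #|J|.
  move=> aS; rewrite cJ; apply: eq_card => b; rewrite inE; apply/idP/idP.
    by apply: N2; apply: (fintype.subsetP SV1).
  exact: SV2.
have degK (k : K) : degree eH (val k) = #|B k|.
  have k1 : val k \in V1 by have := valP k; rewrite inE => /andP[].
  rewrite -(card_imset _ val_inj); apply: eq_card => b; rewrite inE.
  apply/idP/imsetP => [kb|[j + ->]]; last by rewrite inE.
  by exists (exist _ b (N2 _ _ k1 kb) : J); rewrite // inE.
have dB k : (d <= #|B k|)%N.
  by rewrite -degK dV1 //; have := valP k; rewrite inE => /andP[].
have dJ : (d <= #|J|)%N.
  have /card_gt0P[a aS] : (0 < #|S|)%N by rewrite cardS.
  by rewrite -(degS a aS) dV1 //; apply: (fintype.subsetP SV1).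
have -> : num_edges eH = (#|I| * #|J| + \sum_k #|B k|)%N.
  rewrite (card_bipartite_edges eHsym bip) (big_setID S) /= (finset.setIidPr SV1).
  rewrite (eq_bigr (fun=> #|J|) degS) sum_nat_const cI cardS big_sub.
  by congr (_ + _)%N; apply: eq_bigr => k _; rewrite degK.
set T := (\sum_(x : {ffun I -> VG}) cdeg eG x finset.setT ^ d)%N.
have KT : (hom_count (Krd_rel r d) eG <= T)%N by rewrite -cI hom_count_Krd_le.
rewrite -cI in r0 KT *.
(* A positive exponent gives 0 to the power alpha = 0 when K_{r,d} has no homomorphism to G, and
   lets its count be replaced by the upper bound [T]. *)
set alpha := _ / _; have a0 : 0 < alpha.
  rewrite divr_gt0 // ltr0n ?muln_gt0 ?r0 // addn_gt0 muln_gt0 r0.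
  by rewrite (leq_trans d0 dJ).
have [K0|K0] := posnP (hom_count (Krd_rel #|I| d) eG).
  by rewrite /hom_density K0 mul0r powR0 ?gt_eqF // divr_ge0 ?ler0n.
have T0 : (0 < T)%N by apply: leq_trans KT.
have V0 : (0 < #|VG|)%N.
  move: T0; rewrite lt0n sum_nat_eq0 negb_forall => /existsP[x _].
  by have /card_gt0P[i _] := r0; apply/card_gt0P; exists (x i).
have /card_gt0P[v0 _] := V0.
have [h0 bound] := log_density_bound R esym r0 d0 dJ dB (erefl T) (erefl _) T0.
have hH := hom_count_ge v0 eHsym esym bip SV1.
have H0 := leq_trans h0 hH.
have pN k : (0 : R) < (#|VG| ^ k)%:R by rewrite ltr0n expn_gt0 V0.
(* Both densities are now positive, so their logarithms can be compared. *)
rewrite /hom_density card_sum !card_ord /powR.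
rewrite gt_eqF ?divr_gt0 ?pN ?ltr0n //.
rewrite -[X in _ <= X]lnK ?posrE ?divr_gt0 ?pN ?ltr0n // ler_expR.
rewrite !ln_div ?posrE ?pN ?ltr0n // !ln_natX // cH.
apply: le_trans (le_trans bound _); last first.
  by rewrite lerB // ler_ln ?posrE ?ltr0n // ler_nat.
by rewrite ler_wpM2l ?(ltW a0) // lerB // ler_ln ?posrE ?ltr0n // ler_nat.
Qed.
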